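(* Let $G$ be a finitely generated para-$\mathfrak{Nil}$-Hamiltonian group containing a nilpotent subgroup of finite index. Then $\gamma_n(G)$ is finite for some positive integer $n$. Moreover, if $G$ is insoluble, then $G$ is finite.
   Context: A group is minimal non-nilpotent if it is not nilpotent but all its proper subgroups are nilpotent. A group $G$ is para-$\mathfrak{Nil}$-Hamiltonian if $G$ is non-nilpotent and every non-normal subgroup of $G$ is either nilpotent or minimal non-nilpotent. $\gamma_n(G)$ is the $n$-th term of the lower central series ($\gamma_1(G)=G$, $\gamma_{n+1}(G)=[\gamma_n(G),G]$). *)

(* Defs.v *)
From Stdlib Require Import List.

Record Group := {
  carrier :> Type;
  gmul : carrier -> carrier -> carrier;
  ginv : carrier -> carrier;
  gone : carrier;
  gmul_assoc : forall x y z, gmul x (gmul y z) = gmul (gmul x y) z;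
  gmul_1l : forall x, gmul gone x = x;
  gmul_1r : forall x, gmul x gone = x;
  gmul_Vl : forall x, gmul (ginv x) x = gone;
  gmul_Vr : forall x, gmul x (ginv x) = gone
}.

Section GroupDefs.
Variable G : Group.

Definition gset := G -> Prop.

Definition whole : gset := fun _ => True.

Definition subset (A B : gset) : Prop := forall x, A x -> B x.

Definition is_subgroup (H : gset) : Prop :=
  H (gone G) /\
  (forall x y, H x -> H y -> H (gmul G x y)) /\
  (forall x, H x -> H (ginv G x)).

Definition comm_el (x y : G) : G :=
  gmul G (gmul G (ginv G x) (ginv G y)) (gmul G x y).

Definition gen (S : gset) : gset :=
  fun x => forall K, is_subgroup K -> subset S K -> K x.

Definition comm_sub (A B : gset) : gset :=
  gen (fun x => exists a b, A a /\ B b /\ x = comm_el a b).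

(* lower central series of H: gamma H 1 = H, gamma H (n+1) = [gamma H n, H];
   (gamma H 0 := H by convention, never used with n = 0 below) *)
Fixpoint gamma (H : gset) (n : nat) : gset :=
  match n with
  | 0 => H
  | S 0 => H
  | S ((S _) as m) => comm_sub (gamma H m) H
  end.

Fixpoint derived (H : gset) (n : nat) : gset :=
  match n with
  | 0 => H
  | S m => comm_sub (derived H m) (derived H m)
  end.

Definition trivial_set (A : gset) : Prop := forall x, A x -> x = gone G.

Definition nilpotent (H : gset) : Prop := exists n, trivial_set (gamma H n).

Definition soluble (H : gset) : Prop := exists n, trivial_set (derived H n).

Definition normal (H : gset) : Prop :=
  forall g h, H h -> H (gmul G (gmul G (ginv G g) h) g).

Definition proper_sub (K H : gset) : Prop :=
  subset K H /\ exists x, H x /\ ~ K x.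

Definition minimal_non_nilpotent (H : gset) : Prop :=
  ~ nilpotent H /\
  forall K, is_subgroup K -> proper_sub K H -> nilpotent K.

Definition para_Nil_Hamiltonian : Prop :=
  ~ nilpotent whole /\
  forall H, is_subgroup H -> ~ normal H ->
    nilpotent H \/ minimal_non_nilpotent H.

Definition finite_set (A : gset) : Prop :=
  exists l : list G, forall x, A x -> In x l.

Definition finitely_generated : Prop :=
  exists l : list G, forall x, gen (fun y => In y l) x.

Definition finite_index (H : gset) : Prop :=
  exists l : list G, forall x, exists t, In t l /\ H (gmul G (ginv G t) x).

End GroupDefs.

(* Main.v *)
(** Replace the given subgroup by its normal core [N], which is nilpotent and
    finitely generated. Each factor [gamma_i N / gamma_(i+1) N] is a finitely
    generated abelian group, so it has a homomorphism [phi] to a power of [Z] with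
    finite kernel. Let [g] act on the torsion-free quotient [V] by conjugation; this
    action has finite order. The subgroups [L_k = (2^k V) C_G(g)] cannot all be
    normal, nor can one of them be minimal non-nilpotent, unless [g] acts
    unipotently, hence trivially. So [phi] is invariant under conjugation by [G].
    If [gamma_n G] is finite modulo [gamma_i N], the transfer extends a multiple of
    [phi] to [gamma_n G], and its kernel contains [gamma_(n+1) G] and is finite
    modulo [gamma_(i+1) N]; going down the lower central series of [N], some
    [gamma_n G] is finite.

    If [G] is infinite, some [z] of infinite order centralises the finite group
    [F = gamma_n G]. For a non-nilpotent subgroup [X] of [F], the subgroup [X <z>]
    is not minimal non-nilpotent, hence normal, and so is [X = X <z> :&: F] in [F].
    A finite group whose subgroups are all nilpotent or normal is soluble, by
    Schmidt's counting argument. *)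

Require Import Defs.
From Stdlib Require Import List ZArith Lia Classical ClassicalEpsilon Permutation.
From Stdlib Require Import Setoid Morphisms.
From Corelib Require Import ssreflect.
From HB Require Import structures.
From mathcomp Require all_boot all_fingroup all_solvable zify boolp.

Set Implicit Arguments.
Unset Strict Implicit.

(** * Finite groups whose subgroups are nilpotent or normal *)

Module FiniteGroups.
Import all_boot all_fingroup all_solvable zify boolp.
Import GroupScope.

(** * A nonsoluble simple group with all proper subgroups nilpotent: counting in conjugates of
    maximal subgroups *)

Section Schmidt.
Variables (gT : finGroupType) (G : {group gT}).
Hypothesis simG : forall N : {group gT}, N <| G -> N :=: 1 \/ N :=: G.
Hypothesis nilG : forall H : {group gT}, H \proper G -> nilpotent H.
Hypothesis nsolG : ~~ solvable G.

Let ncycG (x : gT) : x \in G -> <[x]> \proper G.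
Proof.
move=> Gx; rewrite properE cycle_subG Gx /=; apply: contra nsolG => sGx.
exact: solvableS sGx (abelian_sol (cycle_abelian x)).
Qed.

Let max_exists (H : {group gT}) : H \proper G ->
  exists2 M : {group gT}, maximal M G & H \subset M.
Proof.
move=> prH; have [M maxM sHM] := maxgroup_exists (gP := fun K : {group gT} => K \proper G) prH.
by exists M.
Qed.

Let max_neq1 (M : {group gT}) : maximal M G -> M :!=: 1.
Proof.
move=> /maxgroupP[prM maxM]; apply/eqP => M1.
have [x Gx ntx] : exists2 x, x \in G & x != 1.
  apply/trivgPn; apply: contra nsolG => /eqP->; exact: solvable1.
have := maxM _ (ncycG Gx); rewrite M1 => /(_ (sub1G _)) /eqP.
by rewrite cycle_eq1 (negPf ntx).
Qed.

Let max_norm (M : {group gT}) : maximal M G -> 'N_G(M) = M.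
Proof.
move=> maxM; have /maxgroupP[prM mx] := maxM.
have sM : M \subset 'N_G(M) by rewrite subsetI normG (proper_sub prM).
have [/eqP eN|neN] := boolP ('N_G(M) == G).
  have nM : M <| G by rewrite /normal (proper_sub prM) -{1}eN subsetIr.
  have [M1|eM] := simG nM; first by have := max_neq1 maxM; rewrite M1 eqxx.
  by move: prM; rewrite eM properxx.
apply: (mx 'N_G(M)%G) => //=.
by rewrite properEneq neN subsetIl.
Qed.

(* A nontrivial intersection of largest order would have a proper normaliser,
   which meets both maximal subgroups in something strictly larger. *)
Let max_TI (M1 M2 : {group gT}) :
  maximal M1 G -> maximal M2 G -> M1 :!=: M2 -> M1 :&: M2 = 1.
Proof.
move=> mx1 mx2; move: {2}(#|G| - #|M1 :&: M2|) (leqnn (#|G| - #|M1 :&: M2|)) => n.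
elim: n M1 M2 mx1 mx2 => [|n IHn] M1 M2 mx1 mx2 len neq.
  have : #|M1 :&: M2| < #|G|.
    apply: (@leq_ltn_trans #|M1|); first exact: subset_leq_card (subsetIl _ _).
    by apply: proper_card; have [] := maxgroupP mx1.
  by rewrite -subn_gt0 ltnNge len.
set I := (M1 :&: M2)%G.
have prop (A B : {group gT}) : maximal A G -> maximal B G -> A :!=: B ->
    (A :&: B)%G \proper A.
  move=> mxA mxB nAB; rewrite properE subsetIl subsetI subxx /=.
  apply/negP => sAB; case/negP: nAB; apply/eqP.
  have /maxgroupP[_ mA] := mxA; have /maxgroupP[prB _] := mxB.
  by rewrite (mA B).
have [//|ntI] := eqVneq (I : {set gT}) 1.
have prI1 : I \proper M1 by apply: prop.
have prI2 : I \proper M2.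
  by rewrite /I /= setIC; apply: prop => //; rewrite eq_sym.
have /maxgroupP[pr1 _] := mx1; have /maxgroupP[pr2 _] := mx2.
have nprop (A : {group gT}) : A \proper G -> I \proper A -> I \proper 'N_A(I).
  by move=> prA prIA; apply: nilpotent_proper_norm => //; apply: nilG.
have prN : 'N_G(I)%G \proper G.
  rewrite properEneq subsetIl andbT; apply/eqP => eN.
  have nI : I <| G.
    by rewrite /normal (subset_trans (proper_sub prI1) (proper_sub pr1)) -{1}eN subsetIr.
  have [I1|IG] := simG nI; first by rewrite I1 eqxx in ntI.
  by move: (proper_sub_trans prI1 (proper_sub pr1)); rewrite IG properxx.
have [M3 mx3 sN3] := max_exists prN.
(* [A :&: M3] contains the normaliser of [I] in [A], which is larger than [I]. If [A] and [M3]
   differed, induction would make that intersection trivial. Hence [M1] and [M2] both equal [M3]. *)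
have eqM (A : {group gT}) : maximal A G -> A \proper G -> I \proper A -> A :=: M3.
  move=> mxA prA prIA; apply/eqP; apply/negPn/negP => nA3.
  have lt : #|I| < #|A :&: M3|.
    apply: proper_card; apply: (proper_sub_trans (nprop A prA prIA)).
    rewrite subsetI subsetIl /=; apply: subset_trans sN3.
    by apply: setSI; apply: proper_sub.
  have A31 : A :&: M3 = 1.
    apply: IHn => //.
    rewrite -ltnS; apply: leq_trans _ len; rewrite ltn_sub2l //.
    apply: leq_trans lt _.
    by apply: leq_trans (subset_leq_card (subsetIl _ _)) (subset_leq_card (proper_sub prA)).
  by move: lt; rewrite A31 cards1 ltnS leqn0 -[_ == 0]negbK -lt0n cardG_gt0.
by case/eqP: neq; rewrite (eqM M1) // (eqM M2).
Qed.

Let max_conj (M : {group gT}) g : maximal M G -> g \in G -> maximal (M :^ g)%G G.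
Proof.
by move=> mxM Gg; rewrite -(conjGid Gg); have := maximalJ M G g => /= ->.
Qed.

Let max_normedTI (M : {group gT}) : maximal M G -> normedTI M^# G M.
Proof.
move=> mxM; have /maxgroupP[prM _] := mxM.
apply/normedTI_P; split.
- by rewrite setD_eq0 subG1 max_neq1.
- by rewrite normD1 (max_norm mxM).
move=> g Gg /pred0Pn[x]; rewrite /= conjD1g => /andP[/setD1P[nx Mx] /setD1P[_ Mgx]].
apply: contraLR nx => nMg; rewrite negbK.
have ne : M :!=: (M :^ g)%G.
  by apply: contra nMg => /eqP eM; rewrite -(max_norm mxM) inE Gg inE /= -eM.
by rewrite -in_set1 -[[set 1]]/(1 : {set gT}) -(max_TI mxM (max_conj mxM Gg) ne) inE Mx.
Qed.

(** The conjugates of a maximal [M] are self-normalising and meet trivially, so they contain |G| -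
    |G:M| nonidentity elements, at least half of |G|. Two disjoint families of this kind exceed the
    |G| - 1 available elements. *)
Lemma simple_minimal_nonnilpotent_false : False.
Proof.
have half (M : {group gT}) : maximal M G ->
    (#|class_support M^# G| + #|G : M| = #|G|)%N /\ #|G : M| <= #|class_support M^# G|.
  move=> mxM; have /maxgroupP[prM _] := mxM.
  rewrite (card_support_normedTI (max_normedTI mxM)); split.
    have := cardsD1 1 M; rewrite group1 -(Lagrange (proper_sub prM)) => ->.
    by rewrite mulnDl mul1n addnC.
  rewrite leq_pmull // card_gt0 setD_eq0 subG1; exact: max_neq1.
have [M mxM _] : exists2 M : {group gT}, maximal M G & 1%G \subset M.
  apply: max_exists; rewrite proper1G; apply: contra nsolG => /eqP->; exact: solvable1.
have /maxgroupP[prM _] := mxM.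
have idx : 1 < #|G : M| by rewrite indexg_gt1; case/andP: prM.
have sG (A : {group gT}) : maximal A G -> class_support A^# G \subset G^#.
  move=> /maxgroupP[prA _]; rewrite class_supportEr; apply/bigcupsP => g Gg.
  by rewrite conjD1g -(conjGid Gg) setSD // conjSg proper_sub.
have cG : #|G| = #|G^#|.+1 by rewrite (cardsD1 1 G) group1.
(* If the conjugates of [M] covered all nonidentity elements, |G:M| would be at most 1. *)
have [x Gx nx] : exists2 x, x \in G^# & x \notin class_support M^# G.
  apply/subsetPn; apply/negP => /subset_leq_card le.
  have [e _] := half _ mxM; move: e le cG idx.
  by set a := #|_|; set b := #|_ : _|; lia.
have [ntx {}Gx] := setD1P Gx.
have [M2 mx2 sx2] := max_exists (ncycG Gx); rewrite cycle_subG in sx2.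
have dis : [disjoint class_support M^# G & class_support M2^# G].
  apply/pred0Pn => -[y /= /andP[/imset2P[a g /setD1P[nta Ma] Gg ->]]].
  case/imset2P => b h /setD1P[_ Mb] Gh eab; case/negP: nx.
  (* If these conjugates coincide, then [x], an element of [M2], lies in a conjugate of [M];
     otherwise they meet trivially. *)
  have [e|ne] := eqVneq (M :^ g) (M2 :^ h).
    have Mx : x \in M :^ (g * h^-1) by rewrite conjsgM e conjsgK.
    rewrite class_supportEr; apply/bigcupP; exists (g * h^-1).
      by rewrite groupM ?groupV.
    by rewrite conjD1g inE inE ntx.
  have := max_TI (max_conj mxM Gg) (max_conj mx2 Gh) ne => /setP/(_ (a ^ g)).
  by rewrite inE memJ_conjg Ma eab memJ_conjg Mb -eab !inE conjg_eq1 (negPf nta).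
have : #|class_support M^# G :|: class_support M2^# G| <= #|G^#|.
  by apply: subset_leq_card; rewrite subUset !sG.
rewrite cardsU; move: dis; rewrite -setI_eq0 => /eqP->; rewrite cards0.
have [e1 l1] := half _ mxM; have [e2 l2] := half _ mx2; lia.
Qed.
End Schmidt.

(** Induction on the order. The hypothesis passes to a normal subgroup and to its quotient; in a
    simple group a normal proper subgroup is trivial, so all proper subgroups are nilpotent. *)
Theorem solvable_nilpotent_or_normal (gT : finGroupType) (G : {group gT}) :
  (forall H : {group gT}, H \subset G -> nilpotent H \/ H <| G) -> solvable G.
Proof.
have [n] := ubnP #|G|; elim: n gT G => // n IHn gT G leG hG.
have [/existsP[N /and3P[nsN ntN neN]]|noN] :=
    boolP [exists N : {group gT}, [&& N <| G, N :!=: 1 & N :!=: G]].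
  have sNG := normal_sub nsN.
  rewrite (series_sol nsN); apply/andP; split.
    apply: IHn => [|H sHN].
      have : #|N| < #|G| by apply: proper_card; rewrite properEneq neN.
      lia.
    have [nH|nH] := hG H (subset_trans sHN sNG); first by left.
    by right; apply: normalS nH.
  apply: IHn => [|H sH]; first exact: leq_trans (ltn_quotient ntN sNG) leG.
  have [K defH sNK sKG] := inv_quotientS nsN sH.
  by rewrite defH; have [nK|nK] := hG K sKG; [left; apply: quotient_nil | right;
    apply: quotient_normal].
apply/negPn/negP => nsolG.
have simG (N : {group gT}) : N <| G -> N :=: 1 \/ N :=: G.
  move=> nsN; move/existsPn/(_ N): noN; rewrite nsN /= negb_and !negbK.
  by case/orP => /eqP; [left | right].
apply: (simple_minimal_nonnilpotent_false simG _ nsolG) => H prH.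
have [//|nH] := hG H (proper_sub prH); have [->|eH] := simG H nH; first exact: nilpotent1.
by move: prH; rewrite eH properxx.
Qed.

Import Defs.

(** * Finite subgroups of an abstract group as finite group types *)

Section FiniteSubgroup.
Variables (G : Group) (F : gset G).
Hypotheses (sgF : is_subgroup G F) (finF : finite_set G F).

(** The two proofs are parameters of the type so that the finite group instances can recover them
    from it. *)
Definition subgroup_type of is_subgroup G F & finite_set G F := {x : G | F x}.
Local Notation T := (subgroup_type sgF finF).

Lemma subgroup_val_inj (x y : T) : sval x = sval y -> x = y.
Proof. by apply: eq_sig_hprop => z; apply: Prop_irrelevance. Qed.

HB.instance Definition _ := gen_eqMixin T.
HB.instance Definition _ := gen_choiceMixin T.

Definition subgroup_elt (x : G) : option T :=
  if pselect (F x) is left Fx then Some (exist _ x Fx) else None.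
Definition subgroup_enum : seq T := undup (pmap subgroup_elt (sval (cid finF))).

Lemma mem_subgroup_enum x : x \in subgroup_enum.
Proof.
rewrite mem_undup; have : In (sval x) (sval (cid finF)).
  by case: cid => l /= /(_ _ (svalP x)).
elim: (sval (cid _)) => //= y l IHl [->|/IHl xl]; rewrite /subgroup_elt /=.
  case: pselect => [Fx|/(_ (svalP x))] //=.
  by rewrite inE; apply/orP; left; apply/eqP; apply: subgroup_val_inj.
by case: pselect => [Fy|_] //=; rewrite inE xl orbT.
Qed.

Lemma index_subgroup_enumK : pcancel (index^~ subgroup_enum) (onth subgroup_enum).
Proof.
move=> x; have xe := mem_subgroup_enum x.
by rewrite onthE (nth_map x) ?index_mem // nth_index.
Qed.
HB.instance Definition _ : isCountable T := PCanIsCountable index_subgroup_enumK.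

Lemma subgroup_enumP : Finite.axiom subgroup_enum.
Proof. by move=> x; rewrite count_uniq_mem ?undup_uniq // mem_subgroup_enum. Qed.
HB.instance Definition _ := isFinite.Build T subgroup_enumP.

Definition sg_mul (x y : T) : T :=
  exist _ (gmul G (sval x) (sval y)) (sgF.2.1 _ _ (svalP x) (svalP y)).
Definition sg_inv (x : T) : T := exist _ (ginv G (sval x)) (sgF.2.2 _ (svalP x)).
Definition sg_one : T := exist _ (gone G) sgF.1.
Lemma sg_mulA : associative sg_mul. 
Proof. by move=> x y z; apply: subgroup_val_inj; rewrite /= gmul_assoc. Qed.
Lemma sg_mul1 : left_id sg_one sg_mul.
Proof. by move=> x; apply: subgroup_val_inj; rewrite /= gmul_1l. Qed.
Lemma sg_mulV : left_inverse sg_one sg_inv sg_mul.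
Proof. by move=> x; apply: subgroup_val_inj; rewrite /= gmul_Vl. Qed.
HB.instance Definition _ := Finite_isGroup.Build T sg_mulA sg_mul1 sg_mulV.

Definition carrier_of (X : {set T}) : gset G := fun x => exists2 y : T, y \in X & sval y = x.

Lemma carrier_of_subgroup (X : {group T}) : is_subgroup G (carrier_of X).
Proof.
split; first by exists 1%g; rewrite ?group1.
split=> [_ _ [x Xx <-] [y Xy <-]|_ [x Xx <-]].
  by exists (x * y)%g; rewrite ?groupM.
by exists (x^-1)%g; rewrite ?groupV.
Qed.

(** Both series start at index 1. This inclusion carries nilpotency from [gamma] to the finite group
    type; [derived_der] carries solubility back. *)
Lemma lcn_gamma (X : {group T}) n (x : T) :
  x \in 'L_n.+1(X)%g -> gamma G (carrier_of X) n.+1 (sval x).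
Proof.
elim: n x => [|n IHn] x; first by rewrite lcn1 => Xx; exists x.
rewrite lcnSn => Lx K sgK sK.
have gK : group_set [set y : T | `[< K (sval y) >]].
  apply/group_setP; split=> [|y z]; rewrite !inE; first exact/asboolP/sgK.1.
  by move=> /asboolP Ky /asboolP Kz; apply/asboolP/sgK.2.1.
suff /subsetP/(_ x Lx) : [~: 'L_n.+1(X), X]%g \subset fingroup.Group gK.
  by rewrite inE => /asboolP.
rewrite gen_subG; apply/subsetP=> _ /imset2P[y z Ly Xz ->].
rewrite inE; apply/asboolP; apply: sK; exists (sval y), (sval z).
split; first exact: IHn.
split; first by exists z.
by rewrite commgEl conjgE /comm_el /= !gmul_assoc.
Qed.

Lemma derived_der n x : derived G F n x -> carrier_of ([set: T]^`(n))%g x.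
Proof.
elim: n x => [|n IHn] x.
  by move=> Fx; exists (exist _ x Fx); rewrite ?derg0 ?inE.
apply; first exact: carrier_of_subgroup.
move=> _ [a [b [/IHn[y Ty <-] [/IHn[z Tz <-] ->]]]].
exists ([~ y, z])%g; first by rewrite dergSn mem_commg.
by rewrite commgEl conjgE /comm_el /= !gmul_assoc.
Qed.

Theorem soluble_nilpotent_or_normal :
  (forall X, is_subgroup G X -> Defs.subset G X F -> Defs.nilpotent G X \/
     forall g h, F g -> X h -> X (gmul G (gmul G (ginv G g) h) g)) ->
  soluble G F.
Proof.
move=> hF; have /derivedP[n Dn] : solvable [set: T].
  apply: solvable_nilpotent_or_normal => X _.
  have sXF : Defs.subset G (carrier_of X) F by move=> _ [y _ <-]; exact: svalP.
  have [[n gn]|nX] := hF _ (carrier_of_subgroup X) sXF.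
    left; apply/lcnP; exists n; apply/trivgP/subsetP => x Lx.
    rewrite inE; apply/eqP/subgroup_val_inj; apply: gn.
    (* [gamma] at 0 is the subgroup itself, so index 0 needs a separate argument; at a successor the
       term 'L used is one step further down than required. *)
    case: n Lx => [|n] Lx; last first.
      apply: lcn_gamma; exact: subsetP (lcn_subS _ _) _ Lx.
    by exists x; rewrite // -(lcn1 X).
  right; rewrite /fingroup.normal subsetT; apply/subsetP => g _; rewrite inE.
  apply/subsetP => _ /imsetP[x Xx ->].
  have [|y Xy e] := nX (sval g) (sval x) (svalP g); first by exists x.
  suff -> : (x ^ g)%g = y by [].
  by apply: subgroup_val_inj; rewrite e conjgE /= !gmul_assoc.
exists n => x /derived_der; rewrite Dn => -[y].
by rewrite inE => /eqP -> <-.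
Qed.
End FiniteSubgroup.

End FiniteGroups.

(** * Pigeonhole principle and divisibility by powers of two *)

Lemma pigeonhole (T : Type) (f : nat -> T) (l : list T) :
  (forall n, In (f n) l) -> exists i j, i < j /\ f i = f j.
Proof.
move=> hf; apply: NNPP => no.
have nd : NoDup (map f (seq 0 (S (length l)))).
  apply: NoDup_map_NoDup_ForallPairs; last exact: seq_NoDup.
  move=> i j _ _ eij; case: (Nat.lt_trichotomy i j) => [lt|[//|lt]]; case: no.
  - by exists i, j.
  - by exists j, i.
have inc : incl (map f (seq 0 (S (length l)))) l.
  by move=> y /in_map_iff [n [<- _]].
have := NoDup_incl_length nd inc; rewrite length_map length_seq; lia.
Qed.

Lemma pow2_divides_0 (z : Z) : (forall k, exists q, z = Z.of_nat (2 ^ k) * q)%Z -> z = 0%Z.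
Proof.
(* The exponent |z| suffices, since 2^|z| > |z| forces the quotient to be 0. *)
move=> h; have [q e] := h (Z.to_nat (Z.abs z)).
have lt := Nat.pow_gt_lin_r 2 (Z.to_nat (Z.abs z)) ltac:(lia).
by case: (Z.eq_dec q 0) => [|nq]; [lia | nia].
Qed.

Lemma pow2_gt0 (k : nat) : (0 < Z.of_nat (2 ^ k))%Z.
Proof. by have := Nat.pow_nonzero 2 k ltac:(lia); lia. Qed.

(** * Subgroups, powers and cosets *)

Section Groups.
Variable G : Group.
Local Notation "x ** y" := (gmul G x y) (at level 40, left associativity).
Local Notation "x ^-1" := (ginv G x) (at level 3, format "x ^-1").
Local Notation e := (gone G).
Implicit Types (A B H K M N S : gset G) (g h x y z : G).

Lemma mulKV x y : x ** (x^-1 ** y) = y.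
Proof. by rewrite gmul_assoc gmul_Vr gmul_1l. Qed.
Lemma mulVK x y : x^-1 ** (x ** y) = y.
Proof. by rewrite gmul_assoc gmul_Vl gmul_1l. Qed.
Lemma inv_uniq x y : x ** y = e -> y = x^-1.
Proof. by move=> h; rewrite -(mulVK x y) h gmul_1r. Qed.
Lemma invM x y : (x ** y)^-1 = y^-1 ** x^-1.
Proof. by symmetry; apply: inv_uniq; rewrite -gmul_assoc mulKV gmul_Vr. Qed.
Lemma invK x : (x^-1)^-1 = x.
Proof. by symmetry; apply: inv_uniq; rewrite gmul_Vl. Qed.
Lemma inv1 : e^-1 = e.
Proof. by symmetry; apply: inv_uniq; rewrite gmul_1l. Qed.

Definition cj x g := g^-1 ** x ** g.

Hint Rewrite <- (gmul_assoc G) : grp.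
Hint Rewrite (gmul_1l G) (gmul_1r G) (gmul_Vl G) (gmul_Vr G) mulKV mulVK invM invK inv1 : grp.
Ltac grp := rewrite /cj /comm_el; autorewrite with grp; try reflexivity.

Lemma cjM x y g : cj (x ** y) g = cj x g ** cj y g. Proof. by grp. Qed.
Lemma cjV x g : cj x^-1 g = (cj x g)^-1. Proof. by grp. Qed.
Lemma cj1 x : cj x e = x. Proof. by grp. Qed.
Lemma cj_mul x g h : cj x (g ** h) = cj (cj x g) h. Proof. by grp. Qed.
Lemma comm_cj x g : comm_el G x g = x^-1 ** cj x g. Proof. by grp. Qed.

Lemma sg1 H : is_subgroup G H -> H e. Proof. by case. Qed.
Lemma sgM H x y : is_subgroup G H -> H x -> H y -> H (x ** y).
Proof. by case=> _ [h _]; apply: h. Qed.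
Lemma sgV H x : is_subgroup G H -> H x -> H x^-1. Proof. by case=> _ [_ h]; apply: h. Qed.
Lemma sgVM H x y : is_subgroup G H -> H x -> H y -> H (x^-1 ** y).
Proof. by move=> sH Hx Hy; apply: sgM => //; apply: sgV. Qed.
Lemma sg_cj H x g : is_subgroup G H -> H x -> H g -> H (cj x g).
Proof. by move=> sH Hx Hg; rewrite /cj; apply: sgM => //; apply: sgVM. Qed.
Lemma sgMl H x y : is_subgroup G H -> H x -> H (x ** y) -> H y.
Proof. by move=> sH Hx Hxy; rewrite -(mulVK x y); apply: sgVM. Qed.

Lemma subset_gen S : subset G S (gen G S).
Proof. by move=> x Sx K _; apply. Qed.
Lemma gen_sg S : is_subgroup G (gen G S).
Proof.
split; first by move=> K sK _; apply: sg1.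
split=> [x y hx hy|x hx] K sK SK; first by apply: sgM => //; [apply: hx | apply: hy].
by apply: sgV => //; apply: hx.
Qed.
Lemma gen_min S K : is_subgroup G K -> subset G S K -> subset G (gen G S) K.
Proof. by move=> sK SK x; apply. Qed.
Lemma gen_cj S g : (forall x, S x -> S (cj x g)) -> forall x, gen G S x -> gen G S (cj x g).
Proof.
move=> hS; apply: (gen_min (K := fun y => gen G S (cj y g))) => [|y Sy];
  last by apply: subset_gen; apply: hS.
split; first by rewrite (_ : cj e g = e); [exact: sg1 (gen_sg _) | grp].
split=> [y z hy hz|y hy]; first by rewrite cjM; apply: (sgM (gen_sg _)).
by rewrite cjV; apply: (sgV (gen_sg _)).
Qed.

(** * Lower central series of a subgroup *)

Lemma gamma_sg H n : is_subgroup G H -> is_subgroup G (gamma G H n).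
Proof. by move=> sH; case: n => [|[|n]] //; apply: gen_sg. Qed.
Lemma gamma_cj H g n : (forall x, H x -> H (cj x g)) ->
  forall x, gamma G H (S n) x -> gamma G H (S n) (cj x g).
Proof.
move=> hH; elim: n => [//|n IHn]; apply: gen_cj => _ [a [b [ha [hb ->]]]].
exists (cj a g), (cj b g); split; first exact: IHn.
by split; [exact: hH | grp].
Qed.
Lemma gamma_normal H n : normal G H -> normal G (gamma G H (S n)).
Proof. by move=> nH g x; apply: gamma_cj => y; apply: nH. Qed.
Lemma gamma_comm H n a b : gamma G H (S n) a -> H b -> gamma G H (S (S n)) (comm_el G a b).
Proof. by move=> ha hb; apply: subset_gen; exists a, b. Qed.
Lemma gamma_decr H n : is_subgroup G H -> subset G (gamma G H (S n)) (gamma G H n).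
Proof.
move=> sH; case: n => [//|n]; apply: gen_min; first exact: gamma_sg.
move=> _ [a [b [ha [hb ->]]]]; rewrite comm_cj; apply: (sgVM (gamma_sg _ sH)) => //.
by apply: gamma_cj => // y hy; apply: sg_cj.
Qed.
Lemma gamma_sub H n : is_subgroup G H -> subset G (gamma G H n) H.
Proof. by move=> sH; elim: n => [//|n IHn] x /(gamma_decr sH) /IHn. Qed.
Lemma gamma_mono H K n : subset G H K -> subset G (gamma G H n) (gamma G K n).
Proof.
move=> sHK; suff h m : subset G (gamma G H (S m)) (gamma G K (S m)) by case: n => [|n] //;
  apply: h.
elim: m => [//|m IHm] x hx L sL KL; apply: hx => // _ [a [b [ha [hb ->]]]].
by apply: KL; exists a, b; split; [exact: IHm | split; [exact: sHK |]].
Qed.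
Lemma nilpotent_sub H K : subset G H K -> nilpotent G K -> nilpotent G H.
Proof. by move=> sHK [n hn]; exists n => x /(gamma_mono sHK) /hn. Qed.

Fixpoint npow x n := match n with O => e | S m => x ** npow x m end.

Lemma npow_add x m n : npow x (m + n) = npow x m ** npow x n.
Proof. by elim: m => [|m IHm] /=; [grp | rewrite IHm; grp]. Qed.
Lemma npow_mul x m n : npow x (m * n) = npow (npow x m) n.
Proof. by elim: n => [|n IHn] /=; [rewrite Nat.mul_0_r |
  rewrite Nat.mul_succ_r Nat.add_comm npow_add IHn]. Qed.
Lemma npow_S x n : npow x (S n) = npow x n ** x.
Proof. by rewrite -Nat.add_1_r npow_add /=; grp. Qed.
Lemma npow_cj x g n : npow (cj x g) n = cj (npow x n) g.
Proof. by elim: n => [|n IHn] /=; [grp | rewrite IHn cjM]. Qed.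
Lemma npow_in H x n : is_subgroup G H -> H x -> H (npow x n).
Proof. by move=> sH Hx; elim: n => [|n IHn] /=; [exact: sg1 | exact: sgM]. Qed.

(** Finitely many left cosets of [M] cover [S]. Containment of [M] in [S] is not built in: for
    subgroups this says that the intersection has finite index in [S]. *)
Definition fmod S M := exists l : list G, forall x, S x -> exists t, In t l /\ M (t^-1 ** x).

Lemma npow_fmod S M x : is_subgroup G M -> fmod S M -> (forall n, S (npow x n)) ->
  exists m, 1 <= m /\ M (npow x m).
Proof.
move=> sM [l hl] hx.
have [f hf] : exists f : nat -> G, forall n, In (f n) l /\ M ((f n)^-1 ** npow x n).
  by apply: (choice (fun n t => In t l /\ M (t^-1 ** npow x n))) => n; apply: hl.
have [i [j [lt eij]]] := pigeonhole (fun n => proj1 (hf n)).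
exists (j - i); split; first lia.
have := sgVM sM (proj2 (hf i)) (proj2 (hf j)); rewrite -eij.
have -> : npow x j = npow x i ** npow x (j - i) by rewrite -npow_add; congr npow; lia.
by grp.
Qed.

Lemma fmod_sub S S' M M' : subset G S' S -> subset G M M' -> fmod S M -> fmod S' M'.
Proof.
by move=> sS sM [l hl]; exists l => x /sS /hl [t [tl Mt]]; exists t; split; last exact: sM.
Qed.

(** Built greedily along the list of cosets: a coset containing an element of [S] not yet covered
    contributes such an element. *)
Lemma transversal S M : is_subgroup G M -> fmod S M -> exists T : list G,
  NoDup T /\ (forall t, In t T -> S t) /\
  (forall x, S x -> exists t, In t T /\ M (t^-1 ** x)) /\
  (forall t u, In t T -> In u T -> M (t^-1 ** u) -> t = u).
Proof.
move=> sM [l hl].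
suff [T [nd [TS [cov sep]]]] : exists T : list G,
    NoDup T /\ (forall t, In t T -> S t) /\
    (forall x, S x -> (exists t, In t l /\ M (t^-1 ** x)) -> exists t, In t T /\
      M (t^-1 ** x)) /\
    (forall t u, In t T -> In u T -> M (t^-1 ** u) -> t = u).
  exists T; split=> //; split=> //; split=> // x Sx; apply: cov => //; exact: hl.
elim: l {hl} => [|a l [T [nd [TS [cov sep]]]]].
  exists nil; split; first exact: NoDup_nil.
  by split=> //; split=> [x _ [t []]|].
case: (classic (exists x, S x /\ M (a^-1 ** x) /\ ~ exists t, In t T /\ M (t^-1 ** x)));
  last first.
  move=> no; exists T; split=> //; split=> //; split=> // x Sx [t [[<- Mx|tl Mx]]]; last first.
    by apply: cov => //; exists t.
  by apply: NNPP => nc; apply: no; exists x.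
move=> [x [Sx [Mx ncov]]]; exists (x :: T); split.
  constructor=> // xT; apply: ncov; exists x; split=> //; rewrite gmul_Vl; exact: sg1.
split; first by move=> t [<-|/TS].
split=> [y Sy [t [[<- My|tl My]]]|t u].
- exists x; split; first by left.
  rewrite (_ : x^-1 ** y = (a^-1 ** x)^-1 ** (a^-1 ** y)); last by grp.
  exact: sgVM.
- have [|u [uT Mu]] := cov y Sy; first by exists t.
  by exists u; split; first right.
have ns u' : In u' T -> ~ M (x^-1 ** u').
  move=> uT Mu; apply: ncov; exists u'; split=> //.
  by rewrite -(invK (u'^-1 ** x)) invM invK; apply: sgV.
move=> [<-|tT] [<-|uT] // Mtu; last exact: sep.
- by case: (ns u).
- by case: (ns t) => //; rewrite -(invK (x^-1 ** t)) invM invK; apply: sgV.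
Qed.

Lemma fmod_trans S M K : is_subgroup G S -> is_subgroup G M ->
  fmod S M -> fmod (fun x => S x /\ M x) K -> fmod S K.
Proof.
move=> sS sM /(transversal sM) [T [_ [TS [cov _]]]] [l hl].
exists (flat_map (fun t => map (gmul G t) l) T) => x Sx.
have [t [tT Mt]] := cov x Sx.
have [|u [ul Ku]] := hl (t^-1 ** x); first by split=> //; apply: sgVM => //; apply: TS.
exists (t ** u); split; last by move: Ku; grp.
by apply/in_flat_map; exists t; split=> //; apply: in_map.
Qed.

Lemma fmod_inter S M M' : is_subgroup G S -> is_subgroup G M -> is_subgroup G M' ->
  fmod S M -> fmod S M' -> fmod S (fun x => M x /\ M' x).
Proof.
move=> sS sM sM' f f'; apply: (fmod_trans (M := M)) => //.
have f2 : fmod (fun x => S x /\ M x) M' by apply: fmod_sub f' => // x [].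
have [T [_ [TS [cov _]]]] := transversal sM' f2.
exists T => x Sx; have [t [tT Mt]] := cov x Sx; exists t; split=> //.
by split=> //; apply: sgVM => //; [case: (TS t tT) | case: Sx].
Qed.


(** * Finite generation, normal cores and lower central factors *)

Definition fgen H := exists l : list G,
  (forall x, In x l -> H x) /\ subset G H (gen G (fun y => In y l)).

(** Schreier's argument: with [Y] generated by the elements [(rep (s ** t))^-1 ** (s ** t)], the set
    [U] of products [T Y] is stable under left multiplication by the generators of [G] and their
    inverses, so it is all of [G]. *)
Lemma schreier H : is_subgroup G H -> fmod (whole G) H -> finitely_generated G -> fgen H.
Proof.
move=> sH [T hT] [l hl].
have [rep hrep] : exists rep : G -> G, forall x, In (rep x) T /\ H ((rep x)^-1 ** x).
  by apply: (choice (fun x t => In t T /\ H (t^-1 ** x))) => x; apply: hT.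
set l' := l ++ map (ginv G) l.
set X := flat_map (fun s => map (fun t => (rep (s ** t))^-1 ** (s ** t)) T) l'.
set Y := gen G (fun y => In y X).
have XH x : In x X -> H x.
  move=> /in_flat_map [s [_ /in_map_iff [t [<- _]]]]; exact: proj2 (hrep _).
have YH : subset G Y H by apply: gen_min.
have sY : is_subgroup G Y by apply: gen_sg.
pose U z := exists t y, In t T /\ Y y /\ z = t ** y.
have Us s z : In s l' -> U z -> U (s ** z).
  move=> sl [t [y [tT [Yy ->]]]].
  exists (rep (s ** t)), ((rep (s ** t))^-1 ** (s ** t) ** y); split;
    first exact: proj1 (hrep _).
  split; last by grp.
  apply: (sgM sY) => //; apply: subset_gen; apply/in_flat_map; exists s; split=> //.
  by apply/in_map_iff; exists t.
have allU g : (forall z, U z -> U (g ** z)) /\ (forall z, U z -> U (g^-1 ** z)).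
  have := hl g; apply: (gen_min (K := fun g => (forall z, U z -> U (g ** z)) /\
    (forall z, U z -> U (g^-1 ** z)))).
    split; first by split=> z; grp.
    split=> [x y [hx hx'] [hy hy']|x [hx hx']]; last by rewrite invK.
    split=> z Uz; first by rewrite -gmul_assoc; apply/hx/hy.
    by rewrite invM -gmul_assoc; apply/hy'/hx'.
  move=> s sl; split=> z; apply: Us; apply/in_app_iff; first by left.
  by right; apply: in_map.
pose Hb t := if excluded_middle_informative (H t) is left _ then true else false.
have HbP t : Hb t = true <-> H t by rewrite /Hb; case: excluded_middle_informative.
(* The identity need not be a representative, so the members of [T] lying in [H] join the
   generators. *)
exists (X ++ filter Hb T); split.
  by move=> x /in_app_iff [xX|/filter_In [_ hx]]; [exact: XH | exact/HbP].
move=> x Hx; have [t0 [t0T _]] := hT e I.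
have [|t [y [tT [Yy exy]]]] := proj1 (allU (x ** t0^-1)) t0.
  by exists t0, e; split=> //; split; [exact: sg1 | grp].
have {}exy : x = t ** y by rewrite -exy; grp.
have Ht : H t.
  rewrite (_ : t = x ** y^-1); last by rewrite exy; grp.
  by apply: sgM => //; apply: sgV => //; apply: YH.
rewrite exy; apply: (sgM (gen_sg _)).
  by apply: subset_gen; apply/in_app_iff; right; apply/filter_In; split=> //; apply/HbP.
apply: (gen_min _ _ Yy); first exact: gen_sg.
by move=> z zX; apply: subset_gen; apply/in_app_iff; left.
Qed.

(** The conjugate of [H] by [g] depends only on the coset of [g], so the core is an intersection of
    finitely many subgroups of finite index. *)
Lemma normal_core H : is_subgroup G H -> fmod (whole G) H ->
  exists N, is_subgroup G N /\ normal G N /\ subset G N H /\ fmod (whole G) N.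
Proof.
move=> sH fH; have [T hT] := fH.
have sHc t : is_subgroup G (fun x => H (cj x t)).
  split; first by rewrite (_ : cj e t = e); [exact: sg1 | grp].
  split=> [x y|x]; first by rewrite cjM; apply: sgM.
  by rewrite cjV; apply: sgV.
have sI (l : list G) : is_subgroup G (fun x => forall t, In t l -> H (cj x t)).
  split; first by move=> t _; apply: (sg1 (sHc t)).
  by split=> [x y hx hy|x hx] t tl; [apply: (sgM (sHc t)) | apply: (sgV (sHc t))]; auto.
have sW : is_subgroup G (whole G) by [].
have fl (l : list G) : fmod (whole G) (fun x => forall t, In t l -> H (cj x t)).
  elim: l => [|t l IHl]; first by exists (e :: nil) => x _; exists e; split; first left.
  apply: (fmod_sub (S := whole G) (M := fun x => H (cj x t) /\ forall u, In u l ->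
    H (cj x u))) => //.
    by move=> x [h1 h2] u [<-|/h2].
  apply: fmod_inter => //.
  exists (map (fun u => t ** u ** t^-1) T) => x _.
  have [u [uT Hu]] := hT (cj x t) I; exists (t ** u ** t^-1); split.
    by apply/in_map_iff; exists u.
  by move: Hu; grp.
exists (fun x => forall g, H (cj x g)); split.
  split; first by move=> g; apply: (sg1 (sHc g)).
  by split=> [x y hx hy|x hx] g; [apply: (sgM (sHc g)) | apply: (sgV (sHc g))].
split; first by move=> g x hx h; have := hx (g ** h); rewrite cj_mul.
split; first by move=> x /(_ e); rewrite cj1.
apply: fmod_sub (fl T) => // x hx g.
have [t [tT Ht]] := hT g I.
rewrite (_ : cj x g = cj (cj x t) (t^-1 ** g)); last by grp.
by apply: sg_cj => //; apply: hx.
Qed.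

(** Modulo the following term the commutator is multiplicative in each argument, so commutators of
    generators of one factor with generators of [H] generate the next factor. *)
Lemma gamma_fgen_mod H n : is_subgroup G H -> fgen H -> exists l : list G,
  (forall x, In x l -> gamma G H (S n) x) /\
  subset G (gamma G H (S n)) (gen G (fun y => In y l \/ gamma G H (S (S n)) y)).
Proof.
move=> sH [X [XH hX]]; elim: n => [|n [l [hl hgl]]].
  exists X; split=> // x Hx; apply: gen_min (hX _ Hx); first exact: gen_sg.
  by move=> y yX; apply: subset_gen; left.
exists (flat_map (fun s => map (comm_el G s) X) l); split.
  move=> x /in_flat_map [s [sl /in_map_iff [t [<- tX]]]]; apply: gamma_comm; auto.
set W := gen G _; have sW : is_subgroup G W by apply: gen_sg.
have W3 y : gamma G H (S (S (S n))) y -> W y by move=> hy; apply: subset_gen; right.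
have sg2 := gamma_sg (S (S n)) sH.
have W2c y h : gamma G H (S (S n)) y -> H h -> W y -> W (cj y h).
  move=> hy Hh Wy; rewrite (_ : cj y h = y ** comm_el G y h); last by grp.
  by apply: (sgM sW) => //; apply: W3; apply: gamma_comm.
have W2c' y h : gamma G H (S (S n)) y -> H h -> W y -> W (cj y h)^-1.
  by move=> hy Hh Wy; apply: (sgV sW); apply: W2c.
have Wl s x : In s l -> H x -> W (comm_el G s x).
  move=> sl Hx; suff [] : H x /\ W (comm_el G s x) by [].
  apply: (gen_min (K := fun x => H x /\ W (comm_el G s x)) _ _ (hX _ Hx)).
    split; first by split; [exact: sg1 | rewrite (_ : comm_el G s e = e); [exact: sg1 | grp]].
    split=> [y z [Hy Wy] [Hz Wz]|y [Hy Wy]]; split; try by [apply: sgM | apply: sgV].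
      rewrite (_ : comm_el _ _ _ = comm_el G s z ** cj (comm_el G s y) z); last by grp.
      by apply: (sgM sW) => //; apply: W2c => //; apply: gamma_comm => //; apply: hl.
    rewrite (_ : comm_el _ _ _ = (cj (comm_el G s y) y^-1)^-1); last by grp.
    by apply: W2c' => //; [apply: gamma_comm => //; apply: hl | apply: sgV].
  move=> t tX; split; first exact: XH.
  apply: subset_gen; left; apply/in_flat_map; exists s; split=> //; exact: in_map.
apply: gen_min => // _ [a [x [ha [Hx ->]]]].
suff [] : gamma G H (S n) a /\ W (comm_el G a x) by [].
have sg1n := gamma_sg (S n) sH.
apply: (gen_min (K := fun a => gamma G H (S n) a /\ W (comm_el G a x)) _ _ (hgl _ ha)).
  split; first by split; [exact: sg1 | rewrite (_ : comm_el G e x = e); [exact: sg1 | grp]].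
  split=> [y z [Hy Wy] [Hz Wz]|y [Hy Wy]]; split; try by [apply: (sgM sg1n) |
    apply: (sgV sg1n)].
    rewrite (_ : comm_el _ _ _ = cj (comm_el G y x) z ** comm_el G z x); last by grp.
    apply: (sgM sW) => //; apply: W2c => //; first exact: gamma_comm.
    exact: (gamma_sub sH Hz).
  rewrite (_ : comm_el _ _ _ = (cj (comm_el G y x) y^-1)^-1); last by grp.
  by apply: W2c' => //; [apply: gamma_comm | apply: sgV => //; apply: (gamma_sub sH Hy)].
move=> s [sl|hs]; first by split; [apply: hl | apply: Wl].
by split; [apply: gamma_decr | apply: W3; apply: gamma_comm].
Qed.

(** * Homomorphisms to powers of [Z] *)

Definition zpow x (n : Z) : G :=
  match n with
  | Z0 => e
  | Zpos p => npow x (Pos.to_nat p)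
  | Zneg p => (npow x (Pos.to_nat p))^-1
  end.

Lemma zpow_nat x n : zpow x (Z.of_nat n) = npow x n.
Proof. by case: n => [//|n]; rewrite /= SuccNat2Pos.id_succ. Qed.
Lemma zpow_opp x n : zpow x (- n) = (zpow x n)^-1.
Proof. by case: n => [|p|p] /=; grp. Qed.
Lemma zpow_succ x n : zpow x (n + 1) = zpow x n ** x.
Proof.
case: (Z_le_gt_dec 0 n) => hn.
  have -> : n = Z.of_nat (Z.to_nat n) by lia.
  by rewrite -(Nat2Z.inj_add _ 1) !zpow_nat Nat.add_1_r npow_S.
have -> : n = (- Z.of_nat (S (Z.to_nat (- n - 1))))%Z by lia.
set k := Z.to_nat _; rewrite (_ : - Z.of_nat (S k) + 1 = - Z.of_nat k)%Z; last lia.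
by rewrite !zpow_opp !zpow_nat /=; grp.
Qed.
Lemma zpow_pred x n : zpow x (n - 1) = zpow x n ** x^-1.
Proof. by rewrite -{2}(Z.sub_add 1 n) zpow_succ; grp. Qed.
Lemma zpow_add x m n : zpow x (m + n) = zpow x m ** zpow x n.
Proof.
elim/Z.peano_ind: n => [|n IHn|n IHn].
- by rewrite Z.add_0_r /=; grp.
- by rewrite -Z.add_1_r Z.add_assoc !zpow_succ IHn; grp.
- by rewrite -Z.sub_1_r Z.add_sub_assoc !zpow_pred IHn; grp.
Qed.
Lemma zpow_mul x (m : nat) n : zpow x (Z.of_nat m * n) = zpow (npow x m) n.
Proof.
elim/Z.peano_ind: n => [|n IHn|n IHn].
- by rewrite Z.mul_0_r.
- by rewrite -Z.add_1_r Z.mul_add_distr_l Z.mul_1_r zpow_add IHn zpow_succ zpow_nat.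
- by rewrite -Z.sub_1_r Z.mul_sub_distr_l Z.mul_1_r -Z.add_opp_r zpow_add IHn zpow_pred zpow_opp zpow_nat.
Qed.
Lemma npow_zpow x n m : npow (zpow x n) m = zpow x (Z.of_nat m * n).
Proof.
by elim: m => [//|m IHm]; rewrite Nat2Z.inj_succ Z.mul_succ_l zpow_add npow_S IHm.
Qed.
Lemma zpow_in H x n : is_subgroup G H -> H x -> H (zpow x n).
Proof. by move=> sH Hx; case: n => [|p|p] /=; [exact: sg1 | exact: npow_in | apply: sgV =>
  //; exact: npow_in]. Qed.

(** Coordinates run over all of [nat], so that no rank has to be recorded; values outside [A] are
    arbitrary. *)
Definition zhom A (phi : G -> nat -> Z) :=
  forall x y i, A x -> A y -> phi (x ** y) i = (phi x i + phi y i)%Z.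

Section ZHom.
Variables (A : gset G) (phi : G -> nat -> Z).
Hypotheses (sA : is_subgroup G A) (hphi : zhom A phi).

Lemma zhom1 i : phi e i = 0%Z.
Proof. by have := hphi i (sg1 sA) (sg1 sA); rewrite gmul_1l; lia. Qed.
Lemma zhomV x i : A x -> phi x^-1 i = (- phi x i)%Z.
Proof. by move=> Ax; have := hphi i (sgV sA Ax) Ax; rewrite gmul_Vl zhom1; lia. Qed.
Lemma zhomX x n i : A x -> phi (npow x n) i = (Z.of_nat n * phi x i)%Z.
Proof.
by move=> Ax; elim: n => [|n IHn]; [rewrite zhom1 |
  rewrite Nat2Z.inj_succ Z.mul_succ_l /= hphi ?IHn //; [lia | exact: npow_in]].
Qed.
Lemma zhom_ker_sg : is_subgroup G (fun x => A x /\ forall i, phi x i = 0%Z).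
Proof.
split; first by split=> [|i]; [exact: sg1 | exact: zhom1].
split=> [x y [Ax hx] [Ay hy]|x [Ax hx]]; split=> [|i].
- exact: sgM.
- by rewrite hphi // hx hy.
- exact: sgV.
- by rewrite zhomV // hx.
Qed.
End ZHom.

(** When [A / B] is a group, [phi] embeds its quotient by a finite torsion subgroup into a power of
    the integers. *)
Definition zmap A B phi := zhom A phi /\ (forall x i, B x -> phi x i = 0%Z) /\
  fmod (fun x => A x /\ forall i, phi x i = 0%Z) B.

(** * Extending a homomorphism by one generator, in an abelian quotient modulo [B] *)

Section Modulo.
Variable B : gset G.
Hypotheses (sB : is_subgroup G B) (nB : normal G B).

Definition eqm x y := B (x^-1 ** y).

Local Instance eqm_equiv : Equivalence eqm.
Proof.
split=> [x|x y|x y z]; rewrite /eqm.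
- by rewrite gmul_Vl; apply: sg1.
- by move=> /(sgV sB); rewrite invM invK.
- by move=> hx hy; have := sgM sB hx hy; grp.
Qed.
Local Instance eqm_mul : Proper (eqm ==> eqm ==> eqm) (gmul G).
Proof.
move=> x x' hx y y' hy; rewrite /eqm.
rewrite (_ : _ ** _ = cj (x^-1 ** x') y ** (y^-1 ** y')); last by grp.
by apply: (sgM sB) => //; apply: nB.
Qed.

Variable C : gset G.
Hypotheses (sC : is_subgroup G C) (cC : forall x y, C x -> C y -> B (comm_el G x y)).

Lemma eqm_comm x y : C x -> C y -> eqm (x ** y) (y ** x).
Proof.
by move=> Cx Cy; rewrite /eqm; have := cC Cy Cx; grp.
Qed.

Lemma eqm_npowM x y n : C x -> C y -> eqm (npow (x ** y) n) (npow x n ** npow y n).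
Proof.
move=> Cx Cy; elim: n => [|n IHn] /=; first by rewrite gmul_1l; reflexivity.
rewrite IHn -!gmul_assoc (gmul_assoc G y).
by rewrite (eqm_comm Cy (npow_in n sC Cx)) -!gmul_assoc; reflexivity.
Qed.

Section Extend.
Variables (A : gset G) (a : G) (phi : G -> nat -> Z).
Hypotheses (sA : is_subgroup G A) (BA : subset G B A) (AC : subset G A C) (Ca : C a).
Hypothesis genC : forall x, C x -> exists n : Z, A ((zpow a n)^-1 ** x).
Hypothesis phiP : zmap A B phi.

Let zhom_eqm x y i : A x -> A y -> eqm x y -> phi x i = phi y i.
Proof.
case: phiP => hom [z0 _] Ax Ay exy.
by rewrite -(mulKV x y) (hom _ _ i Ax (BA exy)) (z0 _ i exy); lia.
Qed.

(** The m-th power map is a homomorphism modulo [B] and sends [C] into [A], so [phi] can be composed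
    with it. On [A] this multiplies [phi] by [m], which keeps the kernel. *)
Lemma zmap_extend_torsion m : 1 <= m -> A (npow a m) -> exists psi, zmap C B psi.
Proof.
case: (phiP) => hom [z0 fk] m1 Am.
have Apow x : C x -> A (npow x m).
  move=> Cx; have [n An] := genC Cx; have Cn := zpow_in n sC Ca.
  set y := _ ** x in An; set w := npow (zpow a n) m ** npow y m.
  have Aw : A w.
    apply: (sgM sA); last exact: npow_in.
    by rewrite npow_zpow zpow_mul; apply: zpow_in.
  have := eqm_npowM m Cn (AC An); rewrite mulKV -/w => /BA h.
  rewrite (_ : npow x m = w ** ((npow x m)^-1 ** w)^-1); last by grp.
  by apply: (sgM sA) => //; apply: (sgV sA).
have homC : zhom C (fun x => phi (npow x m)).
  move=> x y i Cx Cy; rewrite -hom; [|exact: Apow|exact: Apow].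
  by apply: zhom_eqm; [apply: Apow; exact: sgM | apply: (sgM sA); apply: Apow |
    apply: eqm_npowM].
exists (fun x => phi (npow x m)); split=> //; split.
  by move=> x i Bx; apply: z0; apply: npow_in.
apply: (fmod_trans (M := A) (zhom_ker_sg sC homC)) => //.
  (* Reducing the exponent of [a] modulo [m] leaves finitely many cosets of [A] in [C]. *)
  exists (map (npow a) (seq 0 m)) => x [Cx _]; have [n An] := genC Cx.
  have bd := Z.mod_pos_bound n (Z.of_nat m) ltac:(lia).
  have dm := Z.div_mod n (Z.of_nat m) ltac:(lia).
  set r := (n mod _)%Z in bd dm; set q := (n / _)%Z in dm.
  exists (npow a (Z.to_nat r)); split; first by apply: in_map; apply/in_seq; lia.
  rewrite -zpow_nat Z2Nat.id; last lia.
  rewrite (_ : _ ** x = zpow (npow a m) q ** ((zpow a n)^-1 ** x)).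
    by apply: (sgM sA) => //; apply: zpow_in.
  rewrite -zpow_mul dm Z.add_comm zpow_add; grp.
apply: fmod_sub fk => // x [[Cx h] Ax]; split=> // i.
have := h i; rewrite (zhomX sA hom) //; nia.
Qed.

(** Here [C / A] is infinite cyclic. The exponent [f x] of [a] becomes coordinate 0, and [phi] of
    the remaining factor fills the coordinates shifted by one. *)
Lemma zmap_extend_free : (forall m, 1 <= m -> ~ A (npow a m)) -> exists psi, zmap C B psi.
Proof.
case: (phiP) => hom [z0 fk] no.
have inj n : A (zpow a n) -> n = 0%Z.
  case: n => [//|p|p] /= Ap; case: (no (Pos.to_nat p)) => //; try lia.
  by rewrite -(invK (npow a _)); apply: sgV.
have [f hf] : exists f : G -> Z, forall x, C x -> A ((zpow a (f x))^-1 ** x).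
  apply: (choice (fun x n => C x -> A ((zpow a n)^-1 ** x))) => x.
  case: (classic (C x)) => [Cx|nC]; last by exists 0%Z.
  by have [n An] := genC Cx; exists n.
have fE x n : C x -> A ((zpow a n)^-1 ** x) -> f x = n.
  move=> Cx An; suff : (f x - n = 0)%Z by lia.
  apply: inj; rewrite -Z.add_opp_r Z.add_comm zpow_add zpow_opp.
  rewrite (_ : _ ** _ = ((zpow a n)^-1 ** x) ** ((zpow a (f x))^-1 ** x)^-1); last by grp.
  by apply: (sgM sA) => //; apply: sgV => //; apply: hf.
have Cr x : C x -> C ((zpow a (f x))^-1 ** x).
  by move=> Cx; apply: sgVM => //; apply: zpow_in.
have key x y : C x -> C y ->
    eqm ((zpow a (f x + f y))^-1 ** (x ** y)) (((zpow a (f x))^-1 ** x) ** ((zpow a (f y))^-1 ** y)).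
  move=> Cx Cy; have Cz := zpow_in (f y) sC Ca.
  rewrite zpow_add invM -!gmul_assoc.
  by rewrite (gmul_assoc G x) (eqm_comm Cx (sgV sC Cz)) -!gmul_assoc
     (gmul_assoc G (zpow a (f x))^-1 (zpow a (f y))^-1)
     (eqm_comm (sgV sC (zpow_in (f x) sC Ca)) (sgV sC Cz)) -!gmul_assoc; reflexivity.
have fM x y : C x -> C y -> f (x ** y) = (f x + f y)%Z.
  move=> Cx Cy; apply: fE; first exact: sgM.
  have /BA := key x y Cx Cy; set u := _ ** (x ** y); set v :=
    ((zpow a (f x))^-1 ** x) ** _ => h.
  have Av : A v by apply: (sgM sA); apply: hf.
  rewrite (_ : u = v ** (u^-1 ** v)^-1); last by grp.
  by apply: (sgM sA) => //; apply: sgV.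
exists (fun x i => match i with O => f x | S j => phi ((zpow a (f x))^-1 ** x) j end).
split; [|split].
- move=> x y [|i] Cx Cy; first exact: fM.
  rewrite -hom; [|exact: hf|exact: hf].
  apply: zhom_eqm; [by apply: hf; apply: sgM | by apply: (sgM sA); apply: hf |].
  by rewrite fM //; apply: key.
- move=> x i Bx; have Ax := BA Bx.
  have -> : f x = 0%Z by apply: fE; [exact: AC | rewrite /= inv1 gmul_1l].
  by case: i => [//|i] /=; rewrite inv1 gmul_1l; apply: z0.
- apply: fmod_sub fk => // x [Cx h]; have f0 := h 0.
  have := hf x Cx; have h' i := h (S i); rewrite /= in f0 h'.
  rewrite f0 /= inv1 gmul_1l => Ax; split=> // i.
  by have := h' i; rewrite f0 /= inv1 gmul_1l.
Qed.
End Extend.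
End Modulo.

(** Generators are adjoined one at a time, starting from the zero map on [B]; the two extension
    lemmas apply according to whether some positive power of the new generator is already
    present. *)
Lemma zmap_exists A B (l : list G) : is_subgroup G B -> normal G B -> is_subgroup G A ->
  subset G B A -> (forall x, In x l -> A x) -> subset G A (gen G (fun y => In y l \/ B y)) ->
  (forall x y, A x -> A y -> B (comm_el G x y)) -> exists phi, zmap A B phi.
Proof.
move=> sB nB sA BA lA Al cA.
suff [phi [hom [z0 fk]]] : exists phi, zmap (gen G (fun y => In y l \/ B y)) B phi.
  exists phi; split; first by move=> x y i Ax Ay; apply: hom; apply: Al.
  by split=> //; apply: fmod_sub fk => // x [Ax h]; split=> //; apply: Al.
have {Al} : forall x, In x l -> A x by [].
elim: l {lA} => [|a l IHl] lA.
  exists (fun _ _ => 0%Z); split=> //; split=> //; exists (e :: nil) => x [hx _].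
  exists e; split; first by left.
  by rewrite inv1 gmul_1l; apply: (gen_min _ _ hx) => // y [[]|].
have [phi phiP] := IHl (fun x xl => lA x (or_intror xl)).
set A0 := gen G _ in phiP; set C := gen G _.
have sA0 : is_subgroup G A0 by apply: gen_sg.
have sC : is_subgroup G C by apply: gen_sg.
have CA : subset G C A by apply: gen_min => // y [/lA|/BA].
have cC x y : C x -> C y -> B (comm_el G x y) by move=> Cx Cy; apply: cA; apply: CA.
have BA0 : subset G B A0 by move=> x Bx; apply: subset_gen; right.
have A0C : subset G A0 C.
  apply: gen_min => // y [yl|By]; apply: subset_gen; last by right.
  by left; right.
have Ca : C a by apply: subset_gen; left; left.
have genC x : C x -> exists n : Z, A0 ((zpow a n)^-1 ** x).
  move=> Cx; suff [] : C x /\ exists n : Z, A0 ((zpow a n)^-1 ** x) by [].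
  have nA0 x' y : C x' -> A0 y -> A0 (cj y x').
    move=> Cx' Ay; rewrite (_ : cj y x' = y ** comm_el G y x'); last by grp.
    by apply: (sgM sA0) => //; apply: BA0; apply: cC => //; apply: A0C.
  apply: (gen_min (K := fun x => C x /\ exists n : Z, A0 ((zpow a n)^-1 ** x)) _ _ Cx).
    split; first by split; [exact: sg1 | exists 0%Z; rewrite /= gmul_Vl; exact: sg1].
    split=> [y z [Cy [n hn]] [Cz [m hm]]|y [Cy [n hn]]]; split; try by [apply: (sgM sC) |
      apply: (sgV sC)].
      exists (n + m)%Z; rewrite zpow_add.
      rewrite (_ : _ ** _ = cj ((zpow a n)^-1 ** y) (zpow a m) ** ((zpow a m)^-1 ** z));
        last by grp.
      by apply: (sgM sA0) => //; apply: nA0 => //; apply: (zpow_in _ sC).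
    exists (- n)%Z; rewrite zpow_opp invK.
    rewrite (_ : _ ** _ = cj ((zpow a n)^-1 ** y)^-1 (zpow a n)^-1); last by grp.
    by apply: nA0; [apply: (sgV sC); apply: (zpow_in _ sC) | apply: (sgV sA0)].
  move=> y [[<-|yl]|By]; split.
  - exact: Ca.
  - by exists 1%Z; rewrite /= gmul_1r gmul_Vl; apply: sg1.
  - by apply: subset_gen; left; right.
  - by exists 0%Z; rewrite /= inv1 gmul_1l; apply: subset_gen; left.
  - by apply: subset_gen; right.
  - by exists 0%Z; rewrite /= inv1 gmul_1l; apply: subset_gen; right.
case: (classic (exists m, 1 <= m /\ A0 (npow a m))) => [[m [m1 Am]]|no].
  exact: (zmap_extend_torsion sB nB sC cC sA0 BA0 A0C Ca genC phiP m1 Am).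
apply: (zmap_extend_free sB nB sC cC sA0 BA0 A0C Ca genC phiP) => m m1 Am.
by apply: no; exists m.
Qed.

(** * Invariance under conjugation *)

Definition nil_or_minimal := forall H, is_subgroup G H -> ~ normal G H ->
  nilpotent G H \/ minimal_non_nilpotent G H.

Section ConjugationInvariance.
Variables (N A B : gset G) (phi : G -> nat -> Z).
Hypotheses (sN : is_subgroup G N) (fN : fmod (whole G) N).
Hypotheses (sA : is_subgroup G A) (nA : normal G A) (sB : is_subgroup G B) (nB : normal G B).
Hypothesis cAN : forall a n, A a -> N n -> B (comm_el G a n).
Hypothesis BA : subset G B A.
Hypothesis phiP : zmap A B phi.
Hypothesis paraG : nil_or_minimal.

Let hom : zhom A phi := proj1 phiP.
Let phi0 x i : B x -> phi x i = 0%Z := proj1 (proj2 phiP) x i.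
Let Acj x h : A x -> A (cj x h) := fun Ax => nA h Ax.
Let phiV x i : A x -> phi x^-1 i = (- phi x i)%Z := zhomV sA hom i.
Let phiX x n i : A x -> phi (npow x n) i = (Z.of_nat n * phi x i)%Z := zhomX sA hom n i.

(** A kernel element has a positive power in the normal subgroup [B], hence so does its conjugate,
    and the integers are torsion-free. *)
Lemma zmap_ker_cj x h : A x -> (forall i, phi x i = 0%Z) -> forall i, phi (cj x h) i = 0%Z.
Proof.
move=> Ax hx i; have [_ [_ fk]] := phiP.
have [|m [m1 Bm]] := npow_fmod (x := x) sB fk.
  by move=> n; split; [exact: npow_in | move=> j; rewrite phiX // hx; lia].
have := phi0 i (nB h Bm); rewrite -/(cj _ _) -npow_cj phiX; last exact: Acj.
by nia.
Qed.

(** Conjugation therefore acts on the image of [phi], the group V. *)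
Lemma zmap_cj_ext x y h : A x -> A y -> (forall i, phi x i = phi y i) ->
  forall i, phi (cj x h) i = phi (cj y h) i.
Proof.
move=> Ax Ay exy i.
have Axy := sgVM sA Ax Ay.
have := @zmap_ker_cj (x^-1 ** y) h Axy _ i; rewrite cjM cjV hom; [|by apply: (sgV sA);
  apply: Acj|exact: Acj].
rewrite phiV; last exact: Acj.
have k0 j : phi (x^-1 ** y) j = 0%Z by rewrite hom ?phiV ?exy //; [lia | exact: sgV].
by move=> /(_ k0); lia.
Qed.

Variable g : G.
Let d x := comm_el G x g.

Let Ad x : A x -> A (d x).
Proof. by move=> Ax; rewrite /d comm_cj; apply: sgVM => //; apply: Acj. Qed.
Let phid x i : A x -> phi (d x) i = (phi (cj x g) i - phi x i)%Z.
Proof. by move=> Ax; rewrite /d comm_cj hom ?phiV //; [lia | exact: sgV | exact: Acj]. Qed.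

(* The automorphism induced by [g] on [A / ker phi] has finite order, and there
   [d] is that automorphism minus the identity: a unipotent automorphism of
   finite order of a torsion-free abelian group is trivial. *)
Lemma zmap_unipotent2 a : A a -> (forall i, phi (d (d a)) i = 0%Z) ->
  forall i, phi (d a) i = 0%Z.
Proof.
move=> Aa dd i.
have fixd n j : phi (cj (d a) (npow g n)) j = phi (d a) j.
  elim: n j => [|n IHn] j; first by rewrite cj1.
  rewrite /= cj_mul -IHn; apply: zmap_cj_ext; [by apply/Acj/Ad | exact: Ad |] => k.
  by have := dd k; rewrite phid; [lia | exact: Ad].
(* The value grows linearly in [n] with slope [phi (d a) i]; a power of [g] in [N] acts trivially
   modulo [B], so the slope is 0. *)
have lin n : phi (cj a (npow g n)) i = (phi a i + Z.of_nat n * phi (d a) i)%Z.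
  elim: n => [|n IHn]; first by rewrite cj1; lia.
  rewrite Nat2Z.inj_succ Z.mul_succ_l /= cj_mul (_ : cj a g = a ** d a);
    last by rewrite /d; grp.
  rewrite cjM hom; [|exact: Acj|by apply/Acj/Ad].
  by rewrite IHn fixd; lia.
have [//|m [m1 Nm]] := npow_fmod (x := g) sN fN.
have := lin m; rewrite (_ : cj a _ = a ** comm_el G a (npow g m)); last by grp.
have Bc := cAN Aa Nm; rewrite hom ?(phi0 i Bc) //; [|exact: BA].
by nia.
Qed.

Fixpoint iter_comm n x := match n with O => x | S m => d (iter_comm m x) end.

Let Aiter n x : A x -> A (iter_comm n x).
Proof. by move=> Ax; elim: n => [//|n IHn] /=; apply: Ad. Qed.

Lemma zmap_unipotent n a : A a -> (forall i, phi (iter_comm n a) i = 0%Z) ->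
  forall i, phi (d a) i = 0%Z.
Proof.
elim: n => [|n IHn] Aa h.
  by move=> i; rewrite phid // (zmap_ker_cj g Aa h) (h i).
case: n IHn h => [//|n] IHn h; apply: IHn => // i.
by apply: zmap_unipotent2 => //; apply: Aiter.
Qed.

(** The preimage in [A] of 2^k V, with V the image of [phi]. *)
Definition div2 k x := A x /\ exists b, A b /\
  forall i, phi x i = (Z.of_nat (2 ^ k) * phi b i)%Z.

Lemma div2_sg k : is_subgroup G (div2 k).
Proof.
split; first by split; [exact: sg1 | exists e; split=> [|i]; [exact: sg1 |
  rewrite (zhom1 sA hom); lia]].
split=> [x y [Ax [b [Ab hb]]] [Ay [c [Ac hc]]]|x [Ax [b [Ab hb]]]]; split;
  try by [apply: sgM | apply: sgV].
  by exists (b ** c); split=> [|i]; [exact: sgM | rewrite !hom // hb hc; lia].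
by exists b^-1; split=> [|i]; [exact: sgV | rewrite !phiV // hb; lia].
Qed.

Lemma div2_cj_val x b h k : A x -> A b ->
  (forall i, phi x i = (Z.of_nat (2 ^ k) * phi b i)%Z) ->
  forall i, phi (cj x h) i = (Z.of_nat (2 ^ k) * phi (cj b h) i)%Z.
Proof.
move=> Ax Ab hb i; rewrite -phiX; last exact: Acj.
rewrite npow_cj; apply: zmap_cj_ext => //; first exact: npow_in.
by move=> j; rewrite hb phiX.
Qed.

Lemma div2_cj k x h : div2 k x -> div2 k (cj x h).
Proof.
move=> [Ax [b [Ab hb]]]; split; first exact: Acj.
by exists (cj b h); split; [exact: Acj | exact: div2_cj_val].
Qed.

(* The subgroup [L_k] of the header; any subgroup of [C_G(g)] containing [g] could
   replace [C_G(g)]. *)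
Definition div2_cent k y := exists x c, div2 k x /\ c ** g = g ** c /\ y = x ** c.

Lemma div2_cent_sg k : is_subgroup G (div2_cent k).
Proof.
have sD := div2_sg k.
split; first by exists e, e; split; [exact: sg1 | split; grp].
split=> [_ _ [x [c [Dx [cg ->]]]] [x' [c' [Dx' [cg' ->]]]]|_ [x [c [Dx [cg ->]]]]].
  exists (x ** cj x' c^-1), (c ** c'); split; first by apply: (sgM sD) => //; apply: div2_cj.
  by split; [rewrite -gmul_assoc cg' !gmul_assoc cg | grp].
exists (cj x^-1 c), c^-1; split; first by apply: div2_cj; apply: (sgV sD).
split; last by grp.
by rewrite -{1}(gmul_1r G g) -(gmul_Vr G c) (gmul_assoc G g) -cg; grp.
Qed.

Lemma div2_cent_g k : div2_cent k g.
Proof. by exists e, g; split; [exact: sg1 (div2_sg k) | split; grp]. Qed.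

(** The factor of [x] that commutes with [g] contributes nothing to [d x]; the other factor is
    divisible by 2^k in V, and so is its difference with its conjugate. *)
Lemma div2_cent_dvd k x i : A x -> div2_cent k x ->
  exists q, phi (d x) i = (Z.of_nat (2 ^ k) * q)%Z.
Proof.
move=> Ax [y [c [[Ay [b [Ab hb]]] [cg exy]]]].
have Ac : A c by apply: (sgMl sA Ay); rewrite -exy.
exists (phi (cj b g) i - phi b i)%Z.
rewrite phid // exy cjM (hom i (Acj g Ay) (Acj g Ac)) (hom i Ay Ac).
have -> : cj c g = c by rewrite /cj -gmul_assoc cg; grp.
by rewrite (div2_cj_val g Ay Ab hb) hb; lia.
Qed.

Lemma div2_pow k a : A a -> div2 k (npow a (2 ^ k)).
Proof. by move=> Aa; split; [exact: npow_in | exists a; split=> // i; rewrite phiX]. Qed.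

Lemma div2_cent_pow k a : A a -> div2_cent k (npow a (2 ^ k)).
Proof. by move=> Aa; exists (npow a (2 ^ k)), e; split; [exact: div2_pow | split; grp]. Qed.

Let d_pow k a i : A a -> phi (d (npow a (2 ^ k))) i = (Z.of_nat (2 ^ k) * phi (d a) i)%Z.
Proof.
move=> Aa; rewrite !phid //; last exact: npow_in.
by rewrite -npow_cj !phiX //; [lia | exact: Acj].
Qed.

Lemma div2_cent_decr k j : subset G (div2_cent (k + j)) (div2_cent k).
Proof.
move=> _ [x [c [[Ax [b [Ab hb]]] [cg ->]]]]; exists x, c; split=> //; split=> //.
exists (npow b (2 ^ j)); split=> [|i]; first exact: npow_in.
by rewrite hb phiX // Nat.pow_add_r Nat2Z.inj_mul; lia.
Qed.

(** The subgroup contains [g] and [npow a (2 ^ k)], so nilpotency kills an iterated commutator with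
    [g], and unipotence applies. *)
Lemma div2_cent_nilpotent k a i : nilpotent G (div2_cent k) -> A a -> phi (d a) i = 0%Z.
Proof.
move=> [n hn] Aa.
have inn m : gamma G (div2_cent k) (S m) (iter_comm m (npow a (2 ^ k))).
  elim: m => [|m IHm]; first exact: div2_cent_pow.
  by apply: gamma_comm => //; exact: div2_cent_g.
have e1 := hn _ (gamma_decr (div2_cent_sg k) (inn n)).
have := @zmap_unipotent n _ (npow_in (2 ^ k) sA Aa) _ i.
rewrite e1 d_pow // => /(_ (fun i => zhom1 sA hom i)) h.
by have := pow2_gt0 k; nia.
Qed.

Lemma zmap_cj_invariant a i : A a -> phi (cj a g) i = phi a i.
Proof.
move=> Aa; suff : phi (d a) i = 0%Z by rewrite phid //; lia.
case: (classic (exists k, nilpotent G (div2_cent k))) => [[k nk]|nn].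
  exact: div2_cent_nilpotent nk Aa.
(* If all are normal, [d a] is a product of a conjugate of [g^-1] and [g], so it lies in each of
   them; then [phi (d (d a))] is divisible by every power of 2. *)
case: (classic (forall k, normal G (div2_cent k))) => [nL|].
  apply: zmap_unipotent2 => // j; apply: pow2_divides_0 => k.
  apply: div2_cent_dvd; first exact: Ad.
  rewrite /d (_ : comm_el G a g = (cj g a)^-1 ** g); last by grp.
  apply: (sgVM (div2_cent_sg k)); last exact: div2_cent_g.
  by apply: nL; exact: div2_cent_g.
move=> /not_all_ex_not [k nk].
have [nil|[_ mn]] := paraG (div2_cent_sg k) nk; first by case: nn; exists k.
(* No [div2_cent (k + j)] is nilpotent, so by minimality none is proper in [div2_cent k]. *)
have all j : div2_cent (k + j) (npow a (2 ^ k)).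
  apply: NNPP => nj; apply: nn; exists (k + j).
  apply: mn; first exact: div2_cent_sg.
  split; first exact: div2_cent_decr.
  by exists (npow a (2 ^ k)); split=> //; apply: div2_cent_pow.
have : phi (d (npow a (2 ^ k))) i = 0%Z.
  apply: pow2_divides_0 => j.
  have [q ->] := div2_cent_dvd i (npow_in (2 ^ k) sA Aa) (all j).
  by exists (Z.of_nat (2 ^ k) * q)%Z; rewrite Nat.pow_add_r Nat2Z.inj_mul; lia.
by rewrite d_pow // => h; have := pow2_gt0 k; nia.
Qed.
End ConjugationInvariance.

(** * Transfer and finiteness of the lower central series *)

Definition zsum (l : list Z) := fold_right Z.add 0%Z l.

Lemma zsum_perm l l' : Permutation l l' -> zsum l = zsum l'.
Proof. by rewrite /zsum; elim=> //= *; lia. Qed.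

Lemma zsum_mapD (T : Type) (f1 f2 : T -> Z) l :
  zsum (map (fun t => f1 t + f2 t)%Z l) = (zsum (map f1 l) + zsum (map f2 l))%Z.
Proof. by rewrite /zsum; elim: l => //= a l ->; lia. Qed.

Lemma zsum_const (T : Type) (c : Z) (l : list T) : zsum (map (fun _ =>
  c) l) = (Z.of_nat (length l) * c)%Z.
Proof. by elim: l => [//|a l IHl]; rewrite Nat2Z.inj_succ Z.mul_succ_l -IHl Z.add_comm. Qed.

Section Transfer.
Variables (H A : gset G) (phi : G -> nat -> Z).
Hypotheses (sH : is_subgroup G H) (nH : normal G H) (sA : is_subgroup G A) (nA : normal G A).
Hypotheses (hom : zhom A phi) (fH : fmod H A).
Hypothesis phi_cj : forall a g i, A a -> phi (cj a g) i = phi a i.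

(** The transfer into [A] followed by [phi], with [m] the index. Additivity comes from left
    multiplication permuting the cosets; on [A] each term is [phi] of a conjugate, hence [phi]
    itself. *)
Lemma transfer : exists psi m, 1 <= m /\ zhom H psi /\
  forall x i, H x -> A x -> psi x i = (Z.of_nat m * phi x i)%Z.
Proof.
have [T [ndT [TH [cov sep]]]] := transversal sA fH.
have [rep hrep] : exists rep : G -> G, forall x, H x -> In (rep x) T /\ A ((rep x)^-1 ** x).
  apply: (choice (fun x t => H x -> In t T /\ A (t^-1 ** x))) => x.
  case: (classic (H x)) => [/cov [t ht]|nHx]; last by exists e.
  by exists t.
have repE x t : H x -> In t T -> A (t^-1 ** x) -> rep x = t.
  move=> Hx tT At; have [rT Ar] := hrep x Hx; apply: sep => //.
  by have := sgM sA Ar (sgV sA At); grp.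
pose term x i t := phi ((rep (x ** t))^-1 ** (x ** t)) i.
exists (fun x i => zsum (map (term x i) T)), (length T); split; [|split].
- have [t [tT _]] := cov e (sg1 sH).
  by case: (T) tT => //= *; lia.
- move=> x y i Hx Hy.
  have perm : Permutation (map (fun t => rep (y ** t)) T) T.
    apply: NoDup_Permutation_bis.
    + apply: NoDup_map_NoDup_ForallPairs => // t u tT uT etu; apply: sep => //.
      have [_ At] := hrep (y ** t) (sgM sH Hy (TH t tT)).
      have [_ Au] := hrep (y ** u) (sgM sH Hy (TH u uT)).
      by rewrite -etu in Au; have := sgVM sA At Au; grp.
    + by rewrite length_map.
    + move=> _ /in_map_iff [t [<- tT]].
      exact: proj1 (hrep (y ** t) (sgM sH Hy (TH t tT))).
  have -> : zsum (map (term x i) T) = zsum (map (fun t => term x i (rep (y ** t))) T).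
    by rewrite -(map_map (fun t => rep (y ** t)) (term x i));
      apply/zsum_perm/Permutation_map/Permutation_sym.
  rewrite -zsum_mapD; congr zsum; apply: map_ext_in => t tT; rewrite /term.
  have Hyt := sgM sH Hy (TH t tT); have [uT Au] := hrep (y ** t) Hyt.
  set u := rep (y ** t) in uT Au *.
  have Hxu := sgM sH Hx (TH u uT); have [vT Av] := hrep (x ** u) Hxu.
  set v := rep (x ** u) in vT Av *.
  have ev : v^-1 ** (x ** y ** t) = (v^-1 ** (x ** u)) ** (u^-1 ** (y ** t)) by grp.
  have -> : rep (x ** y ** t) = v.
    apply: repE => //; first by rewrite -gmul_assoc; apply: sgM.
    by rewrite ev; apply: sgM.
  by rewrite ev hom.
- move=> x i Hx Ax; rewrite -zsum_const; congr zsum; apply: map_ext_in => t tT.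
  have Ac : A (t^-1 ** (x ** t)) by rewrite gmul_assoc; apply: nA.
  rewrite /term (repE (x ** t) t) //; first by rewrite gmul_assoc; apply: phi_cj.
  by apply: sgM => //; apply: TH.
Qed.

(** The transferred map is conjugation-invariant on all of [H], since some power of each element
    lies in [A]. It thus kills the commutators, while its kernel is finite modulo [B]. *)
Lemma fmod_comm_sub B : zmap A B phi -> fmod (comm_sub G H (whole G)) B.
Proof.
move=> [_ [_ fk]]; have [psi [m [m1 [homp psiA]]]] := transfer.
have sK := zhom_ker_sg sH homp.
have comK : subset G (comm_sub G H (whole G)) (fun x => H x /\ forall i, psi x i = 0%Z).
  apply: gen_min => // _ [h [g [Hh [_ ->]]]].
  have Hc : H (cj h g) by apply: nH.
  rewrite comm_cj; split=> [|i]; first exact: sgVM.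
  rewrite homp ?(zhomV sH homp) //; last exact: sgV.
  have [n|n [n1 An]] := npow_fmod (x := h) sA fH; first exact: npow_in.
  have Hn := npow_in n sH Hh.
  have := zhomX sH homp n i Hc; have := zhomX sH homp n i Hh.
  rewrite npow_cj (psiA _ i Hn An) (psiA _ i (nH g Hn) (nA g An)) (phi_cj g i An).
  by nia.
apply: (fmod_sub comK (M := B)) => //.
apply: (fmod_trans (M := A) sK) => //; first by apply: fmod_sub fH => // x [].
apply: fmod_sub fk => // x [[Hx hx] Ax]; split=> // i.
by have := hx i; rewrite psiA //; nia.
Qed.
End Transfer.

Lemma gamma_whole_sg n : is_subgroup G (gamma G (whole G) n).
Proof. exact: gamma_sg. Qed.

(** * Descent along the lower central series of a nilpotent normal subgroup of finite index *)

Section VirtuallyNilpotent.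
Variable N : gset G.
Hypotheses (sN : is_subgroup G N) (nN : normal G N) (fN : fmod (whole G) N).
Hypotheses (fgN : fgen N) (nilN : nilpotent G N).

Let Ni i := gamma G N (S i).
Let sNi i : is_subgroup G (Ni i) := gamma_sg (S i) sN.
Let nNi i : normal G (Ni i) := @gamma_normal N i nN.

Lemma zmap_gamma i : exists phi, zmap (Ni i) (Ni (S i)) phi.
Proof.
have [l [hl gl]] := gamma_fgen_mod i sN fgN.
apply: (zmap_exists (l := l)) => //; first exact: gamma_decr.
by move=> x y Ax Ay; apply: gamma_comm => //; apply: (gamma_sub sN Ay).
Qed.

Let Ni_trivial : exists c, forall x, Ni c x -> x = e.
Proof. by have [c hc] := nilN; exists c => x /(gamma_decr sN) /hc. Qed.

Lemma gamma_finite : nil_or_minimal -> exists n, 1 <= n /\ finite_set G (gamma G (whole G) n).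
Proof.
move=> para; have [c hc] := Ni_trivial.
suff h i : exists n, fmod (gamma G (whole G) (S n)) (Ni i).
  have [n [l hl]] := h c; exists (S n); split; first lia.
  exists l => x /hl [t [tl /hc]]; rewrite -(gmul_Vl G t) => etx.
  suff -> : x = t by [].
  by rewrite -(mulKV t x) etx; grp.
(* Each step down in [N] costs one term of the series of [G], starting from [G] itself modulo
   [N]. *)
elim: i => [|i [n fn]]; first by exists 0.
have [phi phiP] := zmap_gamma i; exists (S n).
apply: (fmod_comm_sub (H := gamma G (whole G) (S n)) (A := Ni i) (phi := phi)) => //.
- exact: gamma_whole_sg.
- exact: gamma_normal.
- by case: phiP.
- move=> a g j Aa; apply: (zmap_cj_invariant sN fN (sNi i) (@nNi i) (sNi (S i)) (@nNi (S i)) _ _ phiP) => //.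
  + by move=> b m Ab Nm; apply: gamma_comm.
  + exact: gamma_decr.
Qed.

(** In a torsion group every [phi] vanishes, so each factor of the series of [N] is finite, and then
    [G] is finite. *)
Lemma infinite_order_element : ~ finite_set G (whole G) ->
  exists a, forall m, 1 <= m -> npow a m <> e.
Proof.
move=> inf; have [c hc] := Ni_trivial; apply: NNPP => no.
have tors a : exists m, 1 <= m /\ npow a m = e.
  apply: NNPP => nm; apply: no; exists a => m m1 em; apply: nm; by exists m.
suff h i : fmod (whole G) (Ni i).
  apply: inf; have [l hl] := h c; exists l => x /hl [t [tl /hc]]; rewrite -(gmul_Vl G t) => etx.
  suff -> : x = t by [].
  by rewrite -(mulKV t x) etx; grp.
elim: i => [//|i IHi].
apply: (fmod_trans (M := Ni i)) => //.
have [phi [hom [_ fk]]] := zmap_gamma i.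
apply: fmod_sub fk => // x [_ Ax]; split=> // j.
have [m [m1 em]] := tors x; have := zhomX (sNi i) hom m j Ax.
by rewrite em (zhom1 (sNi i) hom); nia.
Qed.
End VirtuallyNilpotent.

Lemma cj_npow_fix x h n : cj x h = x -> cj x (npow h n) = x.
Proof. by move=> hx; elim: n => [|n IHn] /=; [exact: cj1 | rewrite cj_mul hx]. Qed.

(** The conjugates of [y] by powers of [a] stay in the finite [F], so two agree and some positive
    power fixes [y]; exponents are multiplied over the elements of [F]. *)
Lemma npow_centralizes F a : finite_set G F -> normal G F ->
  exists m, 1 <= m /\ forall x, F x -> cj x (npow a m) = x.
Proof.
move=> [l hl] nF.
have one y : F y -> exists k, 1 <= k /\ cj y (npow a k) = y.
  move=> Fy; have [|i [j [lt eij]]] := @pigeonhole _ (fun n => cj y (npow a n)) l.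
    by move=> n; apply: hl; apply: nF.
  exists (j - i); split; first lia.
  have -> : npow a (j - i) = npow a j ** (npow a i)^-1.
    have {2}-> : j = j - i + i by lia.
    by rewrite npow_add; grp.
  by rewrite cj_mul -eij -cj_mul gmul_Vr cj1.
suff [m [m1 hm]] : exists m, 1 <= m /\ forall x, In x l -> F x -> cj x (npow a m) = x.
  by exists m; split=> // x Fx; apply: hm => //; apply: hl.
elim: {hl}l => [|y l [m [m1 hm]]]; first by exists 1; split.
case: (classic (F y)) => Fy; last by exists m; split=> // x [<-|xl] // Fx; apply: hm.
have [k [k1 hk]] := one y Fy; exists (m * k); split; first nia.
move=> x [<-|xl] Fx; last by rewrite npow_mul; apply/cj_npow_fix/hm.
by rewrite Nat.mul_comm npow_mul; apply: cj_npow_fix.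
Qed.

(* A non-nilpotent subgroup [X] of [F] times [<z>] properly contains [X <z^2>],
   so it is not minimal non-nilpotent, hence normal; and it meets [F] in [X]. *)
Lemma nonnilpotent_normal F z X : nil_or_minimal -> is_subgroup G F -> finite_set G F ->
  (forall x, F x -> cj x z = x) -> (forall m, 1 <= m -> npow z m <> e) ->
  is_subgroup G X -> subset G X F -> nilpotent G X \/ forall g h, F g -> X h -> X (cj h g).
Proof.
move=> para sF [l hl] zF zinf sX XF.
have zF' n x : F x -> cj x (zpow z n) = x.
  move=> Fx; case: n => [|p|p] /=; [exact: cj1 | exact/cj_npow_fix/zF |].
  by rewrite -{1}(cj_npow_fix (Pos.to_nat p) (zF x Fx)) -cj_mul gmul_Vr cj1.
have z0 n : zpow z n = e -> n = 0%Z.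
  case: n => [//|p|p] /= ep; case: (zinf (Pos.to_nat p)) => //; try lia.
  by rewrite -(invK (npow z _)) ep inv1.
(* A finite subgroup meets the infinite cyclic group of [z] trivially. *)
have zFe n : F (zpow z n) -> n = 0%Z.
  move=> Fn; have [|i [j [lt eij]]] := @pigeonhole _ (fun k => npow (zpow z n) k) l.
    by move=> k; apply: hl; apply: npow_in.
  move: eij; rewrite !npow_zpow => eij.
  have : zpow z ((Z.of_nat j * n) - (Z.of_nat i * n)) = e.
    by rewrite -Z.add_opp_r zpow_add zpow_opp -eij gmul_Vr.
  by move=> h; have := z0 _ h; nia.
pose XZ (r : Z) y := exists x n, X x /\ y = x ** zpow z (r * n).
have sXZ r : is_subgroup G (XZ r).
  split; first by exists e, 0%Z; split; [exact: sg1 | rewrite Z.mul_0_r /=; grp].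
  split=> [_ _ [x [n [Xx ->]]] [y [m [Xy ->]]]|_ [x [n [Xx ->]]]].
    exists (x ** y), (n + m)%Z; split; first exact: sgM.
    rewrite Z.mul_add_distr_l zpow_add -{1}(zF' (r * n)%Z y (XF y Xy)).
    by grp.
  exists x^-1, (- n)%Z; split; first exact: sgV.
  rewrite Z.mul_opp_r zpow_opp -(zF' (r * n)%Z x^-1 (XF _ (sgV sX Xx))).
  by grp.
have Xsub r : subset G X (XZ r).
  by move=> x Xx; exists x, 0%Z; split=> //; rewrite Z.mul_0_r /=; grp.
case: (classic (nilpotent G X)) => [|nX]; first by left.
have nXZ r : ~ nilpotent G (XZ r) by move=> /(nilpotent_sub (Xsub r)).
right=> g h Fg Xh.
have [nor|nnor] := classic (normal G (XZ 1%Z)); last first.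
  have [/nXZ //|[_ mn]] := para _ (sXZ 1%Z) nnor.
  case: (nXZ 2%Z); apply: mn => //; split.
    by move=> _ [x [n [Xx ->]]]; exists x, (2 * n)%Z; split=> //; rewrite Z.mul_1_l.
  exists z; split; first by exists e, 1%Z; split; [exact: sg1 | rewrite /=; grp].
  (* If [z] were in X <z^2>, an odd power of [z] would lie in [F]. *)
  move=> [x [n [Xx ez]]].
  have : F (zpow z (1 - 2 * n)).
    have ez' : zpow z 1 = z by rewrite /=; grp.
    rewrite -Z.add_opp_r zpow_add zpow_opp ez' {1}ez.
    by rewrite -gmul_assoc gmul_Vr gmul_1r; apply: XF.
  by move=> Fz; have := zFe _ Fz; lia.
have [x [n [Xx ex]]] := nor g h (Xsub _ _ Xh).
have Fn : F (zpow z (1 * n)).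
  apply: (sgMl sF (XF _ Xx)); rewrite -ex -/(cj h g).
  by apply: sg_cj => //; apply: XF.
by rewrite /cj ex (zFe _ Fn) /= gmul_1r.
Qed.

(** * Solubility of [G] from that of a term of its lower central series *)

Lemma derived_gamma n : subset G (derived G (whole G) n) (gamma G (whole G) (S n)).
Proof.
elim: n => [//|n IHn]; apply: gen_min; first exact: gamma_whole_sg.
by move=> _ [a [b [/IHn ha [_ ->]]]]; apply: gamma_comm.
Qed.

Lemma derived_mono H K n : subset G H K -> subset G (derived G H n) (derived G K n).
Proof.
move=> sHK; elim: n => [//|n IHn]; apply: gen_min; first exact: gen_sg.
by move=> _ [a [b [/IHn ha [/IHn hb ->]]]]; apply: subset_gen; exists a, b.
Qed.

Lemma derived_add H m n : derived G H (m + n) = derived G (derived G H m) n.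
Proof. by elim: n => [|n IHn]; rewrite ?Nat.add_0_r ?Nat.add_succ_r //= IHn. Qed.

Lemma soluble_gamma n : 1 <= n -> soluble G (gamma G (whole G) n) -> soluble G (whole G).
Proof.
case: n => [|n] n1; first lia.
move=> [k hk]; exists (n + k) => x; rewrite derived_add =>
  /(derived_mono (derived_gamma (n := n))).
exact: hk.
Qed.

End Groups.

Unset Implicit Arguments.

Theorem mainTheorem12 (G : Group) :
  finitely_generated G ->
  para_Nil_Hamiltonian G ->
  (exists H, is_subgroup G H /\ nilpotent G H /\ finite_index G H) ->
  (exists n, 1 <= n /\ finite_set G (gamma G (whole G) n)) /\
  (~ soluble G (whole G) -> finite_set G (whole G)).
Proof.
move=> fgG [_ para] [H [sH [nilH [l hl]]]].
have [N [sN [nN [NH fN]]]] := normal_core sH (ex_intro _ l (fun x _ => hl x)).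
have nilN := nilpotent_sub NH nilH.
have fgN := schreier sN fN fgG.
have [n [n1 fin]] := gamma_finite sN nN fN fgN nilN para.
split; first by exists n.
move=> nsol; apply: NNPP => inf; apply: nsol; apply: (soluble_gamma n1).
have nF : normal G (gamma G (whole G) n) by case: (n) n1 => [|k] k1; [lia |
  exact: gamma_normal].
have [a ha] := infinite_order_element sN nN fN fgN nilN inf.
have [m [m1 hm]] := npow_centralizes a fin nF.
(* The element [npow a m] serves as [z]: it centralises the finite term and inherits infinite order
   from [a]. *)
apply: (FiniteGroups.soluble_nilpotent_or_normal (gamma_whole_sg G n) fin) => X sX XF.
apply: (nonnilpotent_normal para (gamma_whole_sg G n) fin hm) => // k k1.
by rewrite -npow_mul; apply: ha; nia.
Qed.
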